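(* Let $\mathbf{A}_d\in\mathbb{R}^{n\times n}$, $\mathbf{B}_d\in\mathbb{R}^{n\times m}$, let $\pi:\mathbb{R}^n\to\mathbb{R}^m$ be an $\ell$-layer ReLU-activated feedforward neural network, and consider the closed-loop system $\mathbf{x}(t+1)=\mathbf{f}_{cl}(\mathbf{x}(t)):=\mathbf{A}_d\mathbf{x}(t)+\mathbf{B}_d\pi(\mathbf{x}(t))$ with state set $\mathcal{X}\subset\mathbb{R}^n$, a hybrid zonotope. Suppose that the initial state set $\mathcal{X}_0=\langle\mathbf{G}^c_0,\mathbf{G}^b_0,\mathbf{c}_0,\mathbf{A}^c_0,\mathbf{A}^b_0,\mathbf{b}_0\rangle\subset\mathcal{X}$ and the unsafe set $\mathcal{O}\subset\mathcal{X}$ are both hybrid zonotopes, let $T$ be an arbitrary positive integer, and suppose that for $t=1,\dots,T$, $\mathcal{P}_t=\langle\mathbf{G}^c_t,\mathbf{G}^b_t,\mathbf{c}_t,\mathbf{A}^c_t,\mathbf{A}^b_t,\mathbf{b}_t\rangle$ is the exact $t$-step backward reachable set of $\mathcal{O}$. Then the state trajectories of the closed-loop system starting from $\mathcal{X}_0$ avoid $\mathcal{O}$ within $T$ steps (i.e. for every $\mathbf{x}(0)\in\mathcal{X}_0$, the trajectory satisfies $\mathbf{x}(t)\notin\mathcal{O}$ for $t=1,\dots,T$) if and only if for every $t=1,\dots,T$: $$\min\left\{\|\xi^c\|_\infty\ \left|\ \begin{bmatrix}\mathbf{A}^c_t&\mathbf{0}\\\mathbf{0}&\mathbf{A}^c_0\\\mathbf{G}^c_t&-\mathbf{G}^c_0\end{bmatrix}\xi^c+\begin{bmatrix}\mathbf{A}^b_t&\mathbf{0}\\\mathbf{0}&\mathbf{A}^b_0\\\mathbf{G}^b_t&-\mathbf{G}^b_0\end{bmatrix}\xi^b=\begin{bmatrix}\mathbf{b}_t\\\mathbf{b}_0\\\mathbf{c}_0-\mathbf{c}_t\end{bmatrix},\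 \xi^c\in\mathbb{R}^{n_{g,t}},\ \xi^b\in\{-1,1\}^{n_{b,t}}\right.\right\}>1,$$ where $n_{g,t}$ (resp. $n_{b,t}$) is the sum of the numbers of continuous (resp. binary) generators of $\mathcal{P}_t$ and $\mathcal{X}_0$.
   Context: **Hybrid zonotopes.** A set $\mathcal{Z}\subset\mathbb{R}^N$ is a hybrid zonotope if there are $\mathbf{c}\in\mathbb{R}^N$, $\mathbf{G}^c\in\mathbb{R}^{N\times n_g}$, $\mathbf{G}^b\in\mathbb{R}^{N\times n_b}$, $\mathbf{A}^c\in\mathbb{R}^{n_c\times n_g}$, $\mathbf{A}^b\in\mathbb{R}^{n_c\times n_b}$, $\mathbf{b}\in\mathbb{R}^{n_c}$ such that $$\mathcal{Z}=\{\mathbf{G}^c\xi^c+\mathbf{G}^b\xi^b+\mathbf{c}\;|\;\xi^c\in[-1,1]^{n_g},\ \xi^b\in\{-1,1\}^{n_b},\ \mathbf{A}^c\xi^c+\mathbf{A}^b\xi^b=\mathbf{b}\};$$ this is written $\mathcal{Z}=\langle\mathbf{G}^c,\mathbf{G}^b,\mathbf{c},\mathbf{A}^c,\mathbf{A}^b,\mathbf{b}\rangle$. The columns of $\mathbf{G}^c$ (resp. $\mathbf{G}^b$) are the continuous (resp. binary) generators. The numbers $n_g,n_b,n_c$ may be zero. **Network.** $\pi$ has weights $\mathbf{W}^{(k-1)}$ and biases $\mathbf{v}^{(k-1)}$, $k=1,\dots,\ell$. With $\mathbf{x}^{(0)}=\mathbf{x}$ and $\mathbf{x}^{(k)}=\phi(\mathbf{W}^{(k-1)}\mathbf{x}^{(k-1)}+\mathbf{v}^{(k-1)})$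 for $k=1,\dots,\ell-1$, one sets $\pi(\mathbf{x})=\mathbf{W}^{(\ell-1)}\mathbf{x}^{(\ell-1)}+\mathbf{v}^{(\ell-1)}$. Here $\phi$ applies $ReLU(z)=\max\{z,0\}$ to each component. **Backward reachable set.** The $t$-step backward reachable set of a target set $\mathcal{T}\subset\mathcal{X}$ is the set of states in $\mathcal{X}$ that are mapped into $\mathcal{T}$ by the closed-loop system in exactly $t$ steps: $\mathcal{P}_t(\mathcal{T})=\{\mathbf{x}(0)\in\mathcal{X}\;|\;\mathbf{x}(t)\in\mathcal{T},\ \mathbf{x}(k)=\mathbf{f}_{cl}(\mathbf{x}(k-1)),\ k=1,\dots,t\}$. In the claim, $\mathcal{P}_t=\mathcal{P}_t(\mathcal{O})$. **Convention.** The minimum over an empty feasible set is $+\infty$. *)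

(* Defs.v *)
From mathcomp Require Export all_boot all_order all_algebra.
From mathcomp Require Export all_classical all_reals all_analysis.
Export Order.TTheory GRing.Theory Num.Theory.
Export numFieldNormedType.Exports.

Set Implicit Arguments.
Unset Strict Implicit.
Unset Printing Implicit Defensive.

#[export] Set Implicit Arguments.
#[export] Unset Strict Implicit.
#[export] Unset Printing Implicit Defensive.

Local Open Scope classical_set_scope.
Local Open Scope ring_scope.

Definition unit_box (R : realType) (n : nat) : set 'cV[R]_n :=
  [set xi | forall i, -1 <= xi i 0 <= 1].

Definition sign_vectors (R : realType) (n : nat) : set 'cV[R]_n :=
  [set xi | forall i, xi i 0 = -1 \/ xi i 0 = 1].

(* A generator representation <Gc, Gb, c, Ac, Ab, b>; distinct
   representations may describe the same set. *)
Record hz_rep (R : realType) (N : nat) := HZRep {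
  hz_ng : nat;
  hz_nb : nat;
  hz_nc : nat;
  hz_Gc : 'M[R]_(N, hz_ng);
  hz_Gb : 'M[R]_(N, hz_nb);
  hz_c  : 'cV[R]_N;
  hz_Ac : 'M[R]_(hz_nc, hz_ng);
  hz_Ab : 'M[R]_(hz_nc, hz_nb);
  hz_b  : 'cV[R]_hz_nc
}.

Definition hz_set (R : realType) (N : nat) (Z : hz_rep R N) : set 'cV[R]_N :=
  [set z | exists (xc : 'cV[R]_(hz_ng Z)) (xb : 'cV[R]_(hz_nb Z)),
    [/\ unit_box xc, sign_vectors xb,
        hz_Ac Z *m xc + hz_Ab Z *m xb = hz_b Z
      & z = hz_Gc Z *m xc + hz_Gb Z *m xb + hz_c Z]].

Definition hybrid_zonotope (R : realType) (N : nat) (S : set 'cV[R]_N) : Prop :=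
  exists Z : hz_rep R N, S = hz_set Z.

(* [relu_net R l n m] is the type of l-layer networks from R^n to R^m with
   arbitrary hidden widths; only the last layer is not followed by ReLU. *)
Inductive relu_net (R : realType) : nat -> nat -> nat -> Type :=
| OutputLayer n m (W : 'M[R]_(m, n)) (v : 'cV[R]_m) : relu_net R 1 n m
| HiddenLayer l n p m (W : 'M[R]_(p, n)) (v : 'cV[R]_p) (net : relu_net R l p m)
  : relu_net R l.+1 n m.

Definition relu (R : realType) (n : nat) (x : 'cV[R]_n) : 'cV[R]_n :=
  map_mx (fun z => Num.max z 0) x.

Fixpoint net_fun (R : realType) (l n m : nat) (net : relu_net R l n m) :
    'cV[R]_n -> 'cV[R]_m :=
  match net in relu_net _ _ n m return 'cV[R]_n -> 'cV[R]_m with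
  | OutputLayer _ _ W v => fun x => W *m x + v
  | HiddenLayer _ _ _ _ W v net' => fun x => net_fun net' (relu (W *m x + v))
  end.

Definition closed_loop (R : realType) (n m : nat) (Ad : 'M[R]_n)
    (Bd : 'M[R]_(n, m)) (ctrl : 'cV[R]_n -> 'cV[R]_m) (x : 'cV[R]_n) : 'cV[R]_n :=
  Ad *m x + Bd *m ctrl x.

(* The states at times 1, ..., t - 1 are not required to lie in X. *)
Definition backward_reachable (R : realType) (n : nat)
    (f : 'cV[R]_n -> 'cV[R]_n) (X Tgt : set 'cV[R]_n) (t : nat) :
    set 'cV[R]_n :=
  [set x0 | exists x : nat -> 'cV[R]_n,
    [/\ x 0%N = x0, X (x 0%N), Tgt (x t)
      & forall k, (1 <= k <= t)%N -> x k = f (x k.-1)]].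

Definition trajectory (R : realType) (n : nat) (f : 'cV[R]_n -> 'cV[R]_n)
    (x : nat -> 'cV[R]_n) : Prop :=
  forall t, x t.+1 = f (x t).

Definition avoids_within (R : realType) (n : nat) (f : 'cV[R]_n -> 'cV[R]_n)
    (S0 O : set 'cV[R]_n) (T : nat) : Prop :=
  forall x : nat -> 'cV[R]_n, trajectory f x -> S0 (x 0%N) ->
  forall t, (1 <= t <= T)%N -> ~ O (x t).

(* An attained minimum, with the convention that min(emptyset) = +oo. *)
Definition is_min (R : realType) (S : set R) (mu : \bar R) : Prop :=
  (S = set0 /\ mu = +oo%E) \/ exists r : R, [/\ S r, lbound S r & mu = r%:E].

(* The objective values of the mixed-integer program for P and Z; xc is not
   confined to the unit box. The norm of a column vector in mathcomp-analysis
   is the maximum of the absolute values of its entries, and 0 in dimension 0. *)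
Definition milp_values (R : realType) (n : nat) (P Z : hz_rep R n) : set R :=
  [set r | exists (xc : 'cV[R]_(hz_ng P + hz_ng Z))
                  (xb : 'cV[R]_(hz_nb P + hz_nb Z)),
    [/\ sign_vectors xb,
        col_mx (block_mx (hz_Ac P) 0 0 (hz_Ac Z))
               (row_mx (hz_Gc P) (- hz_Gc Z)) *m xc
        + col_mx (block_mx (hz_Ab P) 0 0 (hz_Ab Z))
                 (row_mx (hz_Gb P) (- hz_Gb Z)) *m xb
        = col_mx (col_mx (hz_b P) (hz_b Z)) (hz_c Z - hz_c P)
      & r = `|xc|]].

(* Main.v *)
(* Intersecting P_t with X_0 amounts to solving the constraints of the program
   with the continuous factors in the unit box, i.e. with objective value at
   most 1, and x(0) lies in P_t exactly when the trajectory hits O at time t.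
   The minimum of a nonempty program exists because the binary factors range
   over a compact set and the continuous ones may be restricted to a ball. *)
Require Import Defs.

Local Open Scope classical_set_scope.
Local Open Scope ring_scope.

(** The norm is a maximum that starts from 0; [0 <= r] covers that start value, also in dimension
    0. *)
Lemma cV_norm_leP (R : realType) (n : nat) (x : 'cV[R]_n) (r : R) :
  0 <= r -> reflect (forall i, `|x i 0| <= r) (`|x| <= r).
Proof.
move=> r_ge0; rewrite [X in reflect _ (X <= _)]/Num.Def.normr /= mx_normrE.
apply: (iffP (bigmax_leP _ _ _ _)) => [[_ xr] i|xr]; first exact: xr (i, 0) _.
by split => // -[i j] _ /=; rewrite (ord1 j).
Qed.

Lemma mx_norm_tr (R : realType) (m n : nat) (x : 'M[R]_(m, n)) : `|x^T| = `|x|.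
Proof.
rewrite /Num.Def.normr /= !mx_normrE.
rewrite (reindex (fun p : 'I_m * 'I_n => (p.2, p.1))) /=.
  by apply: eq_bigr => p _; rewrite mxE.
by exists (fun p => (p.2, p.1)) => [[? ?]|[? ?]].
Qed.

Lemma unit_boxE (R : realType) (n : nat) (x : 'cV[R]_n) :
  unit_box x <-> `|x| <= 1.
Proof.
split=> [x1|/cV_norm_leP x1 i]; last by rewrite -ler_norml; exact: x1.
by apply/cV_norm_leP => // i; rewrite ler_norml; exact: x1.
Qed.

Lemma unit_box_col_mx (R : realType) (m n : nat) (x : 'cV[R]_m) (y : 'cV[R]_n) :
  unit_box (col_mx x y) <-> unit_box x /\ unit_box y.
Proof.
split=> [xy|[x1 y1] i].
  by split=> i; [have := xy (lshift n i) | have := xy (rshift m i)];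
    rewrite (col_mxEu, col_mxEd).
by case: (split_ordP i) => j ->; rewrite (col_mxEu, col_mxEd).
Qed.

Lemma sign_vectors_col_mx (R : realType) (m n : nat) (x : 'cV[R]_m)
    (y : 'cV[R]_n) :
  sign_vectors (col_mx x y) <-> sign_vectors x /\ sign_vectors y.
Proof.
split=> [xy|[x1 y1] i].
  by split=> i; [have := xy (lshift n i) | have := xy (rshift m i)];
    rewrite (col_mxEu, col_mxEd).
by case: (split_ordP i) => j ->; rewrite (col_mxEu, col_mxEd).
Qed.

(** The last block row says that both factor pairs generate the same point, with the centres moved
    to the right-hand side; the other two rows decouple. *)
Lemma milp_constraint (R : realType) (n : nat) (P Z : hz_rep R n)
    (pc : 'cV_(hz_ng P)) (zc : 'cV_(hz_ng Z))
    (pb : 'cV_(hz_nb P)) (zb : 'cV_(hz_nb Z)) :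
  col_mx (block_mx (hz_Ac P) 0 0 (hz_Ac Z))
         (row_mx (hz_Gc P) (- hz_Gc Z)) *m col_mx pc zc
  + col_mx (block_mx (hz_Ab P) 0 0 (hz_Ab Z))
           (row_mx (hz_Gb P) (- hz_Gb Z)) *m col_mx pb zb
  = col_mx (col_mx (hz_b P) (hz_b Z)) (hz_c Z - hz_c P) <->
  [/\ hz_Ac P *m pc + hz_Ab P *m pb = hz_b P,
      hz_Ac Z *m zc + hz_Ab Z *m zb = hz_b Z
    & hz_Gc P *m pc + hz_Gb P *m pb + hz_c P =
      hz_Gc Z *m zc + hz_Gb Z *m zb + hz_c Z].
Proof.
have swap (p z p' z' c d : 'cV[R]_n) :
    p - z + (p' - z') = d - c <-> p + p' + c = z + z' + d.
  rewrite addrACA -opprD (rwP (_ =P _)) [in X in _ <-> X](rwP (_ =P _)).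
  by rewrite subr_eq addrAC eq_sym subr_eq eq_sym [d + _]addrC.
rewrite !mul_col_mx !mul_row_col !mul0mx !mulNmx !addr0 !add0r !add_col_mx.
split.
  by move=> /eq_col_mx[/eq_col_mx[-> ->] /swap].
by move=> [-> -> /swap ->].
Qed.

Lemma milp_values_le1 (R : realType) (n : nat) (P Z : hz_rep R n) :
  (exists2 r, milp_values P Z r & r <= 1) <-> hz_set P `&` hz_set Z !=set0.
Proof.
split=> [[r [xc [xb [+ + ->]]] /unit_boxE]|].
  rewrite -(vsubmxK xc) -(vsubmxK xb) => /sign_vectors_col_mx[Pb Zb].
  move=> /milp_constraint[PA ZA PZ] /unit_box_col_mx[Pc Zc].
  exists (hz_Gc P *m usubmx xc + hz_Gb P *m usubmx xb + hz_c P).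
  by split; [exists (usubmx xc), (usubmx xb) | exists (dsubmx xc), (dsubmx xb)].
move=> [_ [[pc [pb [pc1 pb1 PA ->]]] [zc [zb [zc1 zb1 ZA PZ]]]]].
exists `|col_mx pc zc|; last exact/unit_boxE/unit_box_col_mx.
exists (col_mx pc zc), (col_mx pb zb).
by split => //; [exact/sign_vectors_col_mx | exact/milp_constraint].
Qed.

Lemma continuous_row_mulmx (R : realType) (T : topologicalType) (m n : nat)
    (M : 'M[R]_(m, n)) (g : T -> 'rV[R]_n) (i : 'I_m) :
  continuous g -> continuous (fun p => (M *m (g p)^T) i 0).
Proof.
move=> cg; have -> : (fun p => (M *m (g p)^T) i 0) =
    (fun p => \sum_(j < n) M i j * g p 0 j).
  by apply/funext => p; rewrite mxE; apply: eq_bigr => j _; rewrite mxE.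
apply: continuous_big => [|j _ p]; first exact: add_continuous.
apply: cvgM; first exact: cvg_cst.
by apply: (cvg_comp g (fun x : 'rV[R]_n => x 0 j) (cg p)); exact: coord_continuous.
Qed.

(** This set is a finite product of copies of the two-point set {-1, 1}. *)
Lemma sign_rows_compact (R : realType) (n : nat) :
  compact [set v : 'rV[R]_n | sign_vectors v^T].
Proof.
have -> : [set v : 'rV[R]_n | sign_vectors v^T] =
    [set v | forall i, [set -1; 1] (v ord0 i)].
  by apply/seteqP; split=> v /= sv i; have := sv i; rewrite mxE.
apply: (@rV_compact R n (fun=> [set -1; 1])) => _.
by apply: finite_compact; exact: finite_set2.
Qed.

(** The extreme value theorem applies once the search is restricted to the ball of radius [|xc|],
    where [xc] belongs to the given feasible point. Factors are handled as rows, the form in which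
    the compactness lemmas are applied. *)
Lemma mixed_integer_norm_min (R : realType) (k g b : nat) (A : 'M[R]_(k, g))
    (B : 'M[R]_(k, b)) (d : 'cV[R]_k) (xc : 'cV[R]_g) (xb : 'cV[R]_b) :
  sign_vectors xb -> A *m xc + B *m xb = d ->
  exists (yc : 'cV[R]_g) (yb : 'cV[R]_b),
    [/\ sign_vectors yb, A *m yc + B *m yb = d
      & forall (zc : 'cV[R]_g) (zb : 'cV[R]_b),
          sign_vectors zb -> A *m zc + B *m zb = d -> `|yc| <= `|zc|].
Proof.
move=> sxb xd.
pose ball := [set u : 'rV[R]_g | `|u| <= `|xc|].
pose signs := [set v : 'rV[R]_b | sign_vectors v^T].
pose slack i (p : 'rV[R]_g * 'rV[R]_b) :=
  (A *m p.1^T) i 0 + (B *m p.2^T) i 0.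
pose feasible := [set p | forall i, slack i p = d i 0].
have feasibleE p : feasible p <-> A *m p.1^T + B *m p.2^T = d.
  split=> [pd|pd i]; last by rewrite -pd mxE.
  by apply/matrixP => i j; rewrite ord1 mxE; exact: pd.
have ball_compact : compact ball.
  apply: bounded_closed_compact.
    exists `|xc|; split; first exact: normr_real.
    by move=> r /ltW xr u /= /le_trans; exact.
  apply: (@preimage_closed 'rV[R]_g R Num.Def.normr [set r : R | r <= `|xc|]).
    by move=> u _; exact: norm_continuous.
  exact: closed_le.
have feasible_closed : closed feasible.
  (* One continuous scalar equation per constraint row, each with a closed solution set. *)
  have -> : feasible = \bigcap_i (slack i @^-1` [set r | r = d i 0]).
    by apply/seteqP; split=> p pd i => [_|]; exact: pd.
  apply: closed_bigI => i _; apply: preimage_closed; last exact: closed_eq.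
  move=> p _; apply: cvgD.
    by apply: (continuous_row_mulmx (g := fst)) => q; exact: cvg_fst.
  by apply: (continuous_row_mulmx (g := snd)) => q; exact: cvg_snd.
have compactK : compact ((ball `*` signs) `&` feasible).
  apply: compact_closedI feasible_closed.
  exact: compact_setX ball_compact (@sign_rows_compact R b).
have Kx : ((ball `*` signs) `&` feasible) (xc^T, xb^T).
  split; last by apply/feasibleE; rewrite !trmxK.
  by split; rewrite /ball /signs /= ?mx_norm_tr ?trmxK.
have cf : {within (ball `*` signs) `&` feasible,
    continuous (fun p => `|p.1| : R)}.
  apply: continuous_subspaceT => p.
  by apply: cvg_norm; exact: cvg_fst.
have [[u v] /set_mem[[/= ux sv] /feasibleE uvd] umin] :=
  compact_EVT_min (ex_intro _ _ Kx) compactK cf.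
exists u^T, v^T; split => // zc zb szb zd.
(* A competitor outside the ball has norm above [|xc|], hence above that of the minimiser, which
   lies in the ball. *)
rewrite mx_norm_tr; have [zx|/ltW xz] := leP `|zc| `|xc|; last exact: le_trans xz.
rewrite -(mx_norm_tr zc); apply: (umin (zc^T, zb^T)); apply/mem_set.
split; last by apply/feasibleE; rewrite !trmxK.
by split; rewrite /ball /signs /= ?mx_norm_tr ?trmxK.
Qed.

Lemma milp_min_exists (R : realType) (n : nat) (P Z : hz_rep R n) :
  exists mu, is_min (milp_values P Z) mu.
Proof.
have [empty|/set0P[_ [xc [xb [sxb xd _]]]]] := eqVneq (milp_values P Z) set0.
  by exists +oo%E; left.
have [yc [yb [syb yd ymin]]] := mixed_integer_norm_min sxb xd.
exists `|yc|%:E; right; exists `|yc|; split => //; first by exists yc, yb.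
by move=> _ [zc [zb [szb zd ->]]]; exact: ymin szb zd.
Qed.

Lemma milp_min_gt1 (R : realType) (n : nat) (P Z : hz_rep R n) :
  (exists mu, is_min (milp_values P Z) mu /\ (1%:E < mu)%E) <->
  hz_set P `&` hz_set Z = set0.
Proof.
split=> [[mu [mu_min mu_gt1]]|PZ0].
  apply: contrapT => /eqP/set0P/milp_values_le1[r Sr r_le1].
  case: mu_min => [[S0 _]|[s [_ s_lb mu_s]]]; first by move: Sr; rewrite S0.
  move: mu_gt1; rewrite mu_s lte_fin ltNge.
  by rewrite (le_trans (s_lb _ Sr) r_le1).
(* Attainment gives the strict inequality: a finite minimum is itself an objective value, so being
   at most 1 would yield a common point. *)
have [mu mu_min] := milp_min_exists P Z; exists mu; split=> //.
case: mu_min => [[_ ->]|[r [Sr _ ->]]]; first exact: ltry.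
rewrite lte_fin ltNge; apply/negP => r_le1.
have /milp_values_le1/set0P/eqP : exists2 r, milp_values P Z r & r <= 1.
  by exists r.
by apply.
Qed.

(** The dynamics is deterministic, so the state at time [t] is determined by the initial one. *)
Lemma backward_reachableE (R : realType) (n : nat) (f : 'cV[R]_n -> 'cV[R]_n)
    (X Tgt : set 'cV[R]_n) (t : nat) (x0 : 'cV[R]_n) :
  backward_reachable f X Tgt t x0 <-> X x0 /\ Tgt (iter t f x0).
Proof.
split=> [[x [<- Xx Tx xf]]|[Xx Tx]]; last first.
  by exists (fun k => iter k f x0); split => // -[].
split=> //; suff <- : x t = iter t f (x 0%N) by [].
(* Induction on an index bounded by the fixed horizon [t], since the recurrence is only known up to
   [t]. *)
have: (t <= t)%N by []; elim: {1 3 4}t => // k IH k_lt.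
by rewrite xf //= IH // ltnW.
Qed.

Lemma trajectoryE (R : realType) (n : nat) (f : 'cV[R]_n -> 'cV[R]_n)
    (x : nat -> 'cV[R]_n) (t : nat) :
  trajectory f x -> x t = iter t f (x 0%N).
Proof. by move=> xf; elim: t => //= t <-; exact: xf. Qed.

Theorem proposition1 (R : realType) (n m l : nat)
  (Ad : 'M[R]_n) (Bd : 'M[R]_(n, m)) (net : relu_net R l n m)
  (X : set 'cV[R]_n) (X0 : hz_rep R n) (O : set 'cV[R]_n)
  (T : nat) (P : nat -> hz_rep R n) :
  let f := closed_loop Ad Bd (net_fun net) in
  hybrid_zonotope X ->
  hz_set X0 `<=` X ->
  hybrid_zonotope O ->
  O `<=` X ->
  (0 < T)%N ->
  (forall t, (1 <= t <= T)%N -> hz_set (P t) = backward_reachable f X O t) ->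
  avoids_within f (hz_set X0) O T <->
  (forall t, (1 <= t <= T)%N ->
     exists mu : \bar R, is_min (milp_values (P t) X0) mu /\ (1%:E < mu)%E).
Proof.
move=> f _ X0X _ _ _ PE; split=> [avoid t tT|gt1 x xf X0x t tT Ox].
  apply/milp_min_gt1; rewrite PE //; apply/seteqP; split=> // x0.
  move=> [/backward_reachableE[_ Ot] X0x].
  (* A common point [x0] starts the trajectory of its iterates, which meets [O] at time [t]. *)
  exact: (avoid (fun k => iter k f x0)) tT Ot.
have /milp_min_gt1/seteqP[+ _] := gt1 t tT; move/(_ (x 0%N)); apply.
split=> //; rewrite PE //; apply/backward_reachableE.
(* The inclusion of the initial set in [X] supplies the state constraint of the backward reachable
   set. *)
by split; [exact: X0X | rewrite -trajectoryE].
Qed.
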